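(* Let $\phi=p/q$ with $p,q$ coprime integers, $q\ge1$, let $G=U(1)\leftthreetimes_\phi\mathbb{Z}^2$ be the discrete magnetic translation group, and let $\mathcal{C}_G^\times$ be a $G$-crossed braided tensor category extending a unitary modular tensor category $\mathcal{C}_{\mathbf 0}$, such that $G$ does not permute the anyons, with symmetry fractionalization class determined by the vison $v\in\mathcal{A}$ and the anyon per unit cell $m\in\mathcal{A}$. Let $n\ge1$, $\mathbf g=(e^{2\pi i/n},\mathbf 0)$, and let $0_{\mathbf g}$ be an Abelian $\mathbf g$-defect with $(0_{\mathbf g})^n=v$. Let $\mathbf r_1,\mathbf r_2\in\mathbb{Z}^2$ span a magnetic unit cell, i.e. $\mathbf r_1\times\mathbf r_2=q$. Define the Hall conductivity and the filling per magnetic unit cell modulo 1 by $$e^{2\pi i\bar\sigma_H}:=\mathcal{I}_n(0_{\mathbf g})^{2n},\qquad e^{2\pi i\nu}:=\left(\frac{\eta_{0_{\mathbf g}}(\mathbf r_1,\mathbf r_2)}{\eta_{0_{\mathbf g}}(\mathbf r_2,\mathbf r_1)}\right)^n .$$ Then $\mathfrak{w}(\mathbf r_1,\mathbf r_2)\overline{\mathfrak{w}(\mathbf r_2,\mathbf r_1)}=v^p\times m^q$ and $$e^{2\pi i\nu}=M_{v,m^q}\,e^{2\pi i p\bar\sigma_H}=M_{v,m^q}\,e^{2\pi i q\phi\bar\sigma_H}.$$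
   Context: $U(1)\leftthreetimes_\phi\mathbb{Z}^2$: pairs $(e^{2\pi i z},\mathbf r)$, $\mathbf r=(x,y)\in\mathbb{Z}^2$, with product $(e^{2\pi i z_1},\mathbf r_1)(e^{2\pi i z_2},\mathbf r_2)=(e^{2\pi i(z_1+z_2+\phi w(\mathbf r_1,\mathbf r_2))},\mathbf r_1+\mathbf r_2)$, where $w:\mathbb{Z}^2\times\mathbb{Z}^2\to\mathbb{Z}$ is the bilinear form $w(\mathbf r_1,\mathbf r_2)=x_1y_2$ (Landau gauge), so $w(\mathbf r_1,\mathbf r_2)-w(\mathbf r_2,\mathbf r_1)=\mathbf r_1\times\mathbf r_2=x_1y_2-y_1x_2$. A vector $\mathbf r$ also denotes the element $(1,\mathbf r)$. $\mathcal{C}_{\mathbf 0}$ is a unitary modular tensor category (simple objects: ''anyons''); $\mathcal{A}$ is the finite Abelian group of Abelian (quantum dimension 1) anyons, with $\overline b$ the inverse of $b$; $M_{a,b}=R^{a,b}R^{b,a}$ for $b\in\mathcal{A}$; $\theta_a$ is the topological twist ($\theta_a=R^{a,a}$ for Abelian anyons and Abelian defects). $\mathbf 0$ also denotes the identity of $G$, $\bar{\mathbf g}=\mathbf g^{-1}$. $\mathcal{I}_n(0_{\mathbf g})=\theta_{0_{\mathbf g}}^n\prod_{j=0}^{n-1}\eta_{0_{\mathbf g}}(\mathbf g,\mathbf g^j)$. A $G$-crossed braided tensor category (BTC) $\mathcal{C}_G^\times=\bigoplus_{\mathbf g\in G}\mathcal{C}_{\mathbf g}$ is a $G$-graded unitary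 fusion-type category with trivial component $\mathcal{C}_{\mathbf 0}$, a $G$-action $x\mapsto{}^{\mathbf k}x$ mapping $\mathcal{C}_{\mathbf g}\to\mathcal{C}_{\mathbf{kgk}^{-1}}$, and a $G$-crossed braiding ($c_{\mathbf k}\times a_{\mathbf g}={}^{\mathbf k}a_{\mathbf g}\times c_{\mathbf k}$). Simple objects of $\mathcal{C}_{\mathbf g}$ are called $\mathbf g$-defects; a defect is Abelian if it has quantum dimension 1. Skeletally it is given by data $\{F,R,U,\eta\}$: $F$-symbols satisfying the pentagon equation; $G$-crossed $R$-symbols; phases/matrices $U_{\mathbf k}(a,b;c)$ for the action of $\mathbf k$ on splitting spaces; phases $\eta_x(\mathbf g,\mathbf h)$ relating the action of $\mathbf{gh}$ to the composition of the actions, with $U_{\mathbf 0}=1$, $\eta_0=1$, $\eta_x(\mathbf g,\mathbf 0)=\eta_x(\mathbf 0,\mathbf h)=1$. For Abelian objects subscripts are dropped, and for $a\in\mathcal{C}_{\mathbf g},b\in\mathcal{C}_{\mathbf h},c\in\mathcal{C}_{\mathbf k}$ the consistency equations read $R^{a,c}F^{a,c,{}^{\bar{\mathbf k}}b}R^{b,c}=F^{c,{}^{\bar{\mathbf k}}a,{}^{\bar{\mathbf k}}b}\,U_{\mathbf k}(a,b)\,R^{ab,c}F^{a,b,c}$, $(R^{c,a})^{-1}F^{a,{}^{\bar{\mathbf g}}c,b}(R^{{}^{\bar{\mathbf g}}c,b})^{-1}=F^{c,a,b}\,\eta_c(\mathbf g,\mathbf h)\,(R^{c,ab})^{-1}F^{a,b,{}^{\bar{\mathbf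 h}\bar{\mathbf g}}c}$, $\eta_x(\mathbf g,\mathbf h)\eta_x(\mathbf{gh},\mathbf k)=\eta_{{}^{\bar{\mathbf g}}x}(\mathbf h,\mathbf k)\eta_x(\mathbf g,\mathbf{hk})$, $\eta_a(\mathbf k,\mathbf l)\eta_b(\mathbf k,\mathbf l)U_{\mathbf l}({}^{\bar{\mathbf k}}a,{}^{\bar{\mathbf k}}b)U_{\mathbf k}(a,b)=U_{\mathbf{kl}}(a,b)\eta_{ab}(\mathbf k,\mathbf l)$, and the $G$-crossed ribbon property $R^{b,{}^{\bar{\mathbf h}}a}R^{a,b}=\frac{\theta_{ab}}{\theta_a\theta_b}\frac{U_{\mathbf{gh}}(a,b)}{\eta_a(\mathbf g,\mathbf h)\eta_b(\mathbf h,\bar{\mathbf h}\mathbf{gh})}$. Since $G$ acts trivially on anyons, each $\mathcal{C}_{\mathbf k}$ contains an Abelian defect; once one, $0_{\mathbf k}$, is chosen for each $\mathbf k$ ($0_{\mathbf 0}$ trivial), $0_{\mathbf k}\times0_{\mathbf l}=\mathfrak{w}(\mathbf k,\mathbf l)\times0_{\mathbf{kl}}$ with $\mathfrak{w}$ an $\mathcal{A}$-valued 2-cocycle. Symmetry fractionalization class determined by $(v,m)$ means: $\mathfrak{w}$ is cohomologous to $\mathfrak{w}_{v,m}(\mathbf g_1,\mathbf g_2)=v^{\,c-[c]}\times m^{\,w(\mathbf r_1,\mathbf r_2)}$, $c=z_1+z_2+\phi w(\mathbf r_1,\mathbf r_2)$, where $\mathbf g_i=(e^{2\pi i z_i},\mathbf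 r_i)$ with $z_i\in[0,1)$ and $[c]\in[0,1)$ is the fractional part of $c$ (every class in $\mathcal{H}^2(G,\mathcal{A})\cong\mathcal{A}\times\mathcal{A}$ is of this form). *)

(* Defs.v *)
From HB Require Import structures.
From mathcomp Require Import all_boot all_order all_algebra.
From mathcomp Require Import complex.
From mathcomp Require Import reals trigo.

Set Implicit Arguments.
Unset Strict Implicit.
Unset Printing Implicit Defensive.

Import Order.TTheory GRing.Theory Num.Theory.
Local Open Scope ring_scope.

Definition e2pi (R : realType) (x : R) : R[i] :=
  (cos (2 * pi * x) +i* sin (2 * pi * x))%C.

Section E2pi.
Variable R : realType.
Implicit Types x y : R.

Lemma e2piD x y : e2pi (x + y) = e2pi x * e2pi y.
Proof.
rewrite /e2pi mulrDr cosD sinD; apply/eqP; rewrite eq_complex /= eqxx /=.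
by rewrite addrC.
Qed.

Lemma e2pi0 : e2pi (0 : R) = 1.
Proof. by rewrite /e2pi mulr0 cos0 sin0. Qed.

Lemma norm_e2pi x : `|e2pi x| = 1.
Proof. by rewrite normc_def /= cos2Dsin2 Num.Theory.sqrtr1. Qed.

End E2pi.

Section MagneticTranslations.

(* The Landau-gauge form w and the cross product on Z^2. *)
Definition landau (r s : int * int) : int := r.1 * s.2.
Definition cross (r s : int * int) : int := r.1 * s.2 - r.2 * s.1.

Definition unit_phase (R : realType) : pred (R[i] * (int * int)) :=
  fun x => `|x.1| == 1.

(* The discrete magnetic translation group: pairs (u, r) with u in U(1)
   (a complex number of modulus 1) and r in Z^2; phi only enters through the
   group law. *)
Definition mtg (R : realType) (phi : R) : Type :=
  {x : R[i] * (int * int) | unit_phase x}.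

Variables (R : realType) (phi : R).

HB.instance Definition _ := Choice.on (mtg phi).

Let flux (r s : int * int) : R[i] := e2pi (phi * (landau r s)%:~R).

Let fluxDl r r' s : flux (r + r') s = flux r s * flux r' s.
Proof. by rewrite /flux /landau mulrDl intrD mulrDr e2piD. Qed.

Let fluxDr r s s' : flux r (s + s') = flux r s * flux r s'.
Proof. by rewrite /flux /landau mulrDr intrD mulrDr e2piD. Qed.

Let flux0l s : flux 0 s = 1.
Proof. by rewrite /flux /landau mul0r mulr0 e2pi0. Qed.

Let flux0r r : flux r 0 = 1.
Proof. by rewrite /flux /landau mulr0 mulr0 e2pi0. Qed.

Fact mtg_one_proof : unit_phase (1 : R[i], 0 : int * int).
Proof. by rewrite /unit_phase normr1. Qed.
Definition mtg_one : mtg phi := Sub _ mtg_one_proof.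

Fact mtg_mul_proof (x y : mtg phi) :
  unit_phase ((val x).1 * (val y).1
                * e2pi (phi * (landau (val x).2 (val y).2)%:~R),
              (val x).2 + (val y).2).
Proof.
rewrite /unit_phase !normrM norm_e2pi (eqP (valP x)) (eqP (valP y)).
by rewrite !mulr1.
Qed.
Definition mtg_mul (x y : mtg phi) : mtg phi := Sub _ (mtg_mul_proof x y).

Fact mtg_inv_proof (x : mtg phi) :
  unit_phase ((val x).1^-1 * e2pi (phi * (landau (val x).2 (val x).2)%:~R),
              - (val x).2).
Proof.
by rewrite /unit_phase normrM norm_e2pi normfV (eqP (valP x)) invr1 mulr1.
Qed.
Definition mtg_inv (x : mtg phi) : mtg phi := Sub _ (mtg_inv_proof x).

Let mtgP (x y : mtg phi) :
  (val x).1 = (val y).1 -> (val x).2 = (val y).2 -> x = y.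
Proof.
by move=> h1 h2; apply/val_inj/eqP; rewrite -pair_eqE /pair_eq h1 h2 !eqxx.
Qed.

Fact mtg_mulA : associative mtg_mul.
Proof.
move=> x y z; apply: mtgP; rewrite /=; last by rewrite addrA.
rewrite -!/(flux _ _) fluxDl fluxDr.
by rewrite !mulrA [LHS](ACl (1*2*5*3*6*4)).
Qed.

Fact mtg_mul1 : left_id mtg_one mtg_mul.
Proof.
move=> x; apply: mtgP; rewrite /=; last by rewrite add0r.
by rewrite -!/(flux _ _) flux0l mul1r mulr1.
Qed.

Fact mtg_mulr1 : right_id mtg_one mtg_mul.
Proof.
move=> x; apply: mtgP; rewrite /=; last by rewrite addr0.
by rewrite -!/(flux _ _) flux0r !mulr1.
Qed.

Let phase_neq0 (x : mtg phi) : (val x).1 != 0.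
Proof. by rewrite -normr_eq0 (eqP (valP x)) oner_eq0. Qed.

Fact mtg_mulV : left_inverse mtg_one mtg_inv mtg_mul.
Proof.
move=> x; apply: mtgP; rewrite /=; last by rewrite addNr.
rewrite -!/(flux _ _) [X in X * _]mulrAC mulVf ?phase_neq0 ?mul1r // -fluxDl.
by rewrite subrr flux0l.
Qed.

Fact mtg_mulVr : right_inverse mtg_one mtg_inv mtg_mul.
Proof.
move=> x; apply: mtgP; rewrite /=; last by rewrite subrr.
rewrite -!/(flux _ _) mulrA divff ?phase_neq0 ?mul1r // -fluxDr.
by rewrite subrr flux0r.
Qed.

HB.instance Definition _ := isGroup.Build (mtg phi)
  mtg_mulA mtg_mul1 mtg_mulr1 mtg_mulV mtg_mulVr.

Fact mtr_proof (z : R) (r : int * int) : unit_phase (e2pi z, r).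
Proof. by rewrite /unit_phase norm_e2pi. Qed.

(* The element (e^{2 pi i z}, r); the vector r alone denotes (1, r). *)
Definition mtr (z : R) (r : int * int) : mtg phi := Sub _ (mtr_proof z r).

End MagneticTranslations.

(* Skeletal data {F, R, U, eta} of a G-crossed braided category.  [fus a b c] is
   the dimension of the splitting space V^{ab}_c, with basis vectors
   |a,b;c,mu>, mu < fus a b c.  Basis labels are plain naturals so that no casts
   are needed; entries with an out-of-range label are meaningless and are
   constrained by no law.  Conventions, for b in C_h and k in G:
     |a,b;e,al> |e,c;d,be>
       = \sum_(f,mu,nu) Fsym a b c d e al be f mu nu  |b,c;f,mu> |a,f;d,nu>,
     the braiding b x (h^-1 |> a) -> a x b maps |b,h^-1 |> a;c,mu> to
       \sum_nu Rsym a b c mu nu  |a,b;c,nu>,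
     the action of k maps |k^-1 |> a,k^-1 |> b;k^-1 |> c,mu> to
       \sum_nu Usym k a b c mu nu  |a,b;c,nu>. *)
Record crossed_data (R : realType) (G : groupType) := CrossedData {
  obj :> choiceType;
  grade : obj -> G;
  sector : G -> seq obj;
  vac : obj;
  dual : obj -> obj;
  fus : obj -> obj -> obj -> nat;
  act : G -> obj -> obj;
  Fsym : obj -> obj -> obj -> obj ->
         obj -> nat -> nat -> obj -> nat -> nat -> R[i];
  Rsym : obj -> obj -> obj -> nat -> nat -> R[i];
  Usym : G -> obj -> obj -> obj -> nat -> nat -> R[i];
  etasym : obj -> G -> G -> R[i] } as D.

Arguments vac {R G D}.

Local Notation "k |> a" := (act k%g a) (at level 35, right associativity).

Section Invariants.
Context {R : realType} {G : groupType} {D : crossed_data R G}.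
Implicit Types a b c : D.

Definition qdim a : R[i] :=
  `|Fsym a (dual a) a a vac 0 0 vac 0 0|^-1.

Definition abelian a : bool := qdim a == 1.

(* For a in C_g one has g |> a = a, so that R^{a,a}_c is an endomorphism of
   V^{aa}_c and its trace makes sense. *)
Definition twist a : R[i] :=
  \sum_(c <- sector D (grade a * grade a)%g) \sum_(mu < fus a a c)
    qdim c / qdim a * Rsym a a c mu mu.

(* The S-matrix, without the normalization by the total quantum dimension. *)
Definition Sentry a b : R[i] :=
  \sum_(c <- sector D (grade a * (grade b)^-1)%g)
    (fus a (dual b) c)%:R * twist c / (twist a * twist b) * qdim c.

Definition Smatrix : 'M[R[i]]_(size (sector D 1%g)) :=
  \matrix_(i, j) Sentry (nth vac (sector D 1%g) i) (nth vac (sector D 1%g) j).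

(* R^{ab}_c is unitary, so this is its inverse. *)
Definition Rinv a b c (mu nu : nat) : R[i] := (Rsym a b c nu mu)^*.

End Invariants.

Section CrossedLaws.
Variables (R : realType) (G : groupType) (D : crossed_data R G).
Local Notation N := (@fus R G D).
Local Notation F := (@Fsym R G D).
Local Notation Rs := (@Rsym R G D).
Local Notation U := (@Usym R G D).
Local Notation gr := (@grade R G D).
Local Notation delta mu nu := ((mu == nu :> nat)%:R : R[i]).
Implicit Types (a b c d e f m x : D) (g h k : G).

(* The G-graded fusion rules, with finitely many simple objects in each sector
   and a faithful grading. *)
Record graded_fusion_laws : Prop := {
  sector_uniq : forall g, uniq (sector D g);
  mem_sector : forall g a, (a \in sector D g) = (gr a == g);
  sector_neq0 : forall g, sector D g != [::];
  grade_fus : forall a b c, N a b c != 0%N -> gr c = (gr a * gr b)%g;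
  fus_vacl : forall a b, N vac a b = (a == b);
  fus_vacr : forall a b, N a vac b = (a == b);
  fus_dual : forall a b, N a b vac = (b == dual a);
  dualK : forall a, dual (dual a) = a;
  fusA : forall a b c d,
    (\sum_(e <- sector D (gr a * gr b)) N a b e * N e c d
     = \sum_(f <- sector D (gr b * gr c)) N b c f * N a f d)%N }.

(* Unitary associator.  [qdim_dual] and [qdim_fus] are the standard properties of
   the quantum dimension of a unitary fusion category. *)
Record unitary_F_laws : Prop := {
  pentagon : forall a b c d e (f g k l : D)
      (al : 'I_(N a b f)) (be : 'I_(N f c g)) (ga : 'I_(N g d e))
      (de : 'I_(N c d l)) (la : 'I_(N b l k)) (mu : 'I_(N a k e)),
    \sum_(nu < N f l e)
       F f c d e g be ga l de nu * F a b l e f al nu k la mu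
    = \sum_(h <- sector D (gr b * gr c)) \sum_(si < N b c h)
      \sum_(ps < N a h g) \sum_(rh < N h d k)
       F a b c g f al be h si ps * F a h d e g ps ga k rh mu
       * F b c d k h si rh l de la;
  F_unitaryl : forall a b c d e e' (al : 'I_(N a b e)) (be : 'I_(N e c d))
      (al' : 'I_(N a b e')) (be' : 'I_(N e' c d)),
    \sum_(f <- sector D (gr b * gr c)) \sum_(mu < N b c f) \sum_(nu < N a f d)
       F a b c d e al be f mu nu * (F a b c d e' al' be' f mu nu)^*
    = (e == e')%:R * delta al al' * delta be be';
  F_unitaryr : forall a b c d f f' (mu : 'I_(N b c f)) (nu : 'I_(N a f d))
      (mu' : 'I_(N b c f')) (nu' : 'I_(N a f' d)),
    \sum_(e <- sector D (gr a * gr b)) \sum_(al < N a b e) \sum_(be < N e c d)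
       (F a b c d e al be f mu nu)^* * F a b c d e al be f' mu' nu'
    = (f == f')%:R * delta mu mu' * delta nu nu';
  F_vac1 : forall b c d (be mu : 'I_(N b c d)),
    F vac b c d b 0 be d mu 0 = delta be mu;
  F_vac2 : forall a c d (be nu : 'I_(N a c d)),
    F a vac c d a 0 be c 0 nu = delta be nu;
  F_vac3 : forall a b d (al nu : 'I_(N a b d)),
    F a b vac d d al 0 b 0 nu = delta al nu;
  qdim_dual : forall a, qdim (dual a) = qdim a;
  qdim_fus : forall a b,
    qdim a * qdim b
    = \sum_(c <- sector D (gr a * gr b)) (N a b c)%:R * qdim c }.

(* The G-action by unitary tensor autoequivalences. *)
Record action_laws : Prop := {
  act_one : forall a, 1%g |> a = a;
  act_mul : forall g h a, (g * h) |> a = g |> h |> a;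
  grade_act : forall k a, gr (k |> a) = (k * gr a * k^-1)%g;
  act_self : forall a, gr a |> a = a;
  fus_act : forall k a b c, N (k |> a) (k |> b) (k |> c) = N a b c;
  U_unitary : forall k a b c (mu nu : 'I_(N a b c)),
    \sum_(la < N a b c) U k a b c mu la * (U k a b c nu la)^* = delta mu nu;
  U_one : forall a b c (mu nu : 'I_(N a b c)),
    U 1%g a b c mu nu = delta mu nu;
  U_vacl : forall k a, U k vac a a 0 0 = 1;
  U_vacr : forall k a, U k a vac a 0 0 = 1;
  eta_phase : forall x g h, `|etasym x g h| = 1;
  eta_vac : forall g h, etasym (vac : D) g h = 1;
  eta_1r : forall x g, etasym x g 1%g = 1;
  eta_1l : forall x h, etasym x 1%g h = 1;
  U_F : forall k a b c d e f
      (al : 'I_(N a b e)) (be : 'I_(N e c d))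
      (mu : 'I_(N b c f)) (nu : 'I_(N a f d)),
    \sum_(al' < N a b e) \sum_(be' < N e c d)
       U k (k |> a) (k |> b) (k |> e) al al'
       * U k (k |> e) (k |> c) (k |> d) be be'
       * F (k |> a) (k |> b) (k |> c) (k |> d) (k |> e) al' be' (k |> f) mu nu
    = \sum_(mu' < N b c f) \sum_(nu' < N a f d)
       F a b c d e al be f mu' nu'
       * U k (k |> b) (k |> c) (k |> f) mu' mu
       * U k (k |> a) (k |> f) (k |> d) nu' nu;
  eta_U : forall k (l : G) a b c (mu nu : 'I_(N a b c)),
    etasym a k l * etasym b k l
    * \sum_(la < N a b c)
        U l (k^-1 |> a) (k^-1 |> b) (k^-1 |> c) mu la * U k a b c la nu
    = U (k * l)%g a b c mu nu * etasym c k l;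
  eta_cocycle : forall x g h k,
    etasym x g h * etasym x (g * h)%g k
    = etasym (g^-1 |> x) h k * etasym x g (h * k)%g }.

(* The G-crossed braiding: G-equivariance of R, the two heptagon equations and
   the ribbon property. *)
Record braiding_laws : Prop := {
  fusC : forall a b c, N a b c = N b ((gr b)^-1 |> a) c;
  R_unitary : forall a b c (mu nu : 'I_(N a b c)),
    \sum_(la < N a b c) Rs a b c mu la * (Rs a b c nu la)^* = delta mu nu;
  R_vacl : forall a, Rs vac a a 0 0 = 1;
  R_vacr : forall a, Rs a vac a 0 0 = 1;
  R_equivariant : forall k a b c (mu nu : 'I_(N a b c)), let h := gr b in
    etasym (k |> a) (k * h * k^-1)%g k
    * \sum_(la < N a b c)
        U k (k |> b) ((k * h^-1) |> a) (k |> c) mu la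
        * Rs (k |> a) (k |> b) (k |> c) la nu
    = etasym (k |> a) k h
    * \sum_(la < N a b c)
        Rs a b c mu la * U k (k |> a) (k |> b) (k |> c) la nu;
  heptagon_over : forall a b c d e f, let k := gr c in
    forall (al : 'I_(N c (k^-1 |> a) e)) (be : 'I_(N e (k^-1 |> b) d))
      (mu : 'I_(N b c f)) (nu : 'I_(N a f d)),
    \sum_(la < N a c e) \sum_(ga < N c (k^-1 |> b) f)
       Rs a c e al la * F a c (k^-1 |> b) d e la be f ga nu * Rs b c f ga mu
    = \sum_(m <- sector D (gr a * gr b))
      \sum_(si < N (k^-1 |> a) (k^-1 |> b) (k^-1 |> m))
      \sum_(ps < N c (k^-1 |> m) d) \sum_(ze < N a b m) \sum_(om < N m c d)
       F c (k^-1 |> a) (k^-1 |> b) d e al be (k^-1 |> m) si ps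
       * U k a b m si ze * Rs m c d ps om * F a b c d m ze om f mu nu;
  heptagon_under : forall a b c d e f, let g := gr a in let h := gr b in
    forall (al : 'I_(N c a e)) (be : 'I_(N e b d))
      (mu : 'I_(N b ((h^-1 * g^-1) |> c) f)) (nu : 'I_(N a f d)),
    \sum_(la < N a (g^-1 |> c) e) \sum_(ga < N (g^-1 |> c) b f)
       Rinv c a e al la * F a (g^-1 |> c) b d e la be f ga nu
       * Rinv (g^-1 |> c) b f ga mu
    = \sum_(m <- sector D (gr a * gr b)) \sum_(si < N a b m)
      \sum_(ps < N c m d) \sum_(om < N m ((h^-1 * g^-1) |> c) d)
       F c a b d e al be m si ps * etasym c g h * Rinv c m d ps om
       * F a b ((h^-1 * g^-1) |> c) d m si om f mu nu;
  ribbon : forall a b c (mu nu : 'I_(N a b c)), let g := gr a in let h := gr b in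
    \sum_(la < N a b c) Rs b (h^-1 |> a) c mu la * Rs a b c la nu
    = twist c / (twist a * twist b) * U (g * h)%g a b c mu nu
      / (etasym a g h * etasym b h (h^-1 * g * h)%g) }.

End CrossedLaws.

Record crossed_BTC (R : realType) (G : groupType) := CrossedBTC {
  cdata :> crossed_data R G;
  cfusion : graded_fusion_laws cdata;
  cassoc : unitary_F_laws cdata;
  caction : action_laws cdata;
  cbraiding : braiding_laws cdata }.

(* The trivial component of a crossed_BTC is a unitary ribbon fusion category;
   it is a unitary modular tensor category when its S-matrix is nondegenerate. *)
Definition extends_UMTC (R : realType) (G : groupType) (C : crossed_BTC R G) :=
  @Smatrix R G C \in unitmx.

Section AbelianSector.
Context {R : realType} {G : groupType} {C : crossed_BTC R G}.
Implicit Types a b : C.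

Definition anyon a : bool := grade a == 1%g.

Definition abelian_anyon a : bool := anyon a && abelian a.

(* a x b, for Abelian a or b: the only simple object c with fus a b c != 0. *)
Definition fuse a b : C :=
  head vac [seq c <- sector C (grade a * grade b)%g | fus a b c != 0%N].

Definition fexpn a (n : nat) : C := iter n (fuse a) vac.

Definition fexpz a (z : int) : C :=
  match z with
  | Posz n => fexpn a n
  | Negz n => fexpn (dual a) n.+1
  end.

Definition Rabelian a b : R[i] := Rsym a b (fuse a b) 0 0.

Definition mutual_stat a b : R[i] := Rabelian a b * Rabelian b a.

Definition Iinv (n : nat) a : R[i] :=
  twist a ^+ n * \prod_(j < n) etasym a (grade a) (grade a ^+ j)%g.

End AbelianSector.

Definition anyons_not_permuted (R : realType) (G : groupType)
    (C : crossed_BTC R G) : Prop :=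
  forall (k : G) (a : C), anyon a -> k |> a = a.

(* A choice k |-> 0_k of an Abelian k-defect for every k. *)
Definition abelian_defect_choice (R : realType) (G : groupType)
    (C : crossed_BTC R G) (zero : G -> C) : Prop :=
  zero 1%g = vac /\ forall k, grade (zero k) = k /\ abelian (zero k).

(* 0_k x 0_l = w(k,l) x 0_{kl} *)
Definition defect_cocycle (R : realType) (G : groupType)
    (C : crossed_BTC R G) (zero : G -> C) (w : G -> G -> C) : Prop :=
  forall k l, abelian_anyon (w k l) /\
    fuse (zero k) (zero l) = fuse (w k l) (zero (k * l)%g).

(* w is cohomologous to the cocycle v^{c - [c]} x m^{w(r1,r2)} with
   c = z1 + z2 + phi w(r1,r2); every element of the group is (e^{2 pi i z}, r)
   for a unique z in [0,1), and c - [c] is the floor of c. *)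
Definition fractionalization_class (R : realType) (phi : R)
    (C : crossed_BTC R (mtg phi)) (w : mtg phi -> mtg phi -> C)
    (v m : C) : Prop :=
  exists2 ep : mtg phi -> C, (forall k, abelian_anyon (ep k)) &
    forall (z1 z2 : R) (r1 r2 : int * int),
      0 <= z1 < 1 -> 0 <= z2 < 1 ->
      let g1 := mtr phi z1 r1 in let g2 := mtr phi z2 r2 in
      let c := z1 + z2 + phi * (landau r1 r2)%:~R in
      w g1 g2 = fuse (fuse (fuse (ep g1) (ep g2)) (dual (ep (g1 * g2)%g)))
                     (fuse (fexpz v (Num.floor c)) (fexpz m (landau r1 r2))).

(* Main.v *)
(* An object of quantum dimension 1 has one-dimensional fusion spaces with every
   other such object, so the data restricted to Abelian defects are phases.
   Combining the two heptagon equations cancels the F-symbols and gives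
     M(ab,c) U_k(a,b) = M(a,c) M(b,c) eta_c(g,h)
   for a in C_g, b in C_h, c in C_k.  With c an anyon and a = 0_k, b = 0_l it
   says that eta_c(k,l)/eta_c(l,k) is the braiding of c with
   w(k,l)/w(l,k) when k and l commute.  By the law relating eta and U, this
   commutator of eta is multiplicative in the defect, so that the n-th power of
   the commutator of eta_x is the braiding of x^n = v with v^p m^q, that is
   M(v,m^q) M(v,v)^p.  Finally, the ribbon property and the identity above for
   the powers of x give theta_v = I_n(x)^n, hence
   M(v,v) = theta_v^2 = I_n(x)^(2n). *)

Require Import Defs.
From HB Require Import structures.
From mathcomp Require Import all_boot all_order all_algebra.
From mathcomp Require Import complex.
From mathcomp Require Import reals trigo.
From mathcomp Require Import ring.

Set Implicit Arguments.
Unset Strict Implicit.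
Unset Printing Implicit Defensive.

Import Order.TTheory GRing.Theory Num.Theory.
Local Open Scope ring_scope.

(** Multiplicity sums collapse with this when a fusion space is one-dimensional; its dimension
    equals 1 only propositionally, hence the cast of the index. *)
Lemma big_ord_eq1 (V : Type) (idx : V) (op : Monoid.law idx) (n : nat)
    (n1 : n = 1%N) (F : 'I_n -> V) :
  \big[op/idx]_(i < n) F i = F (cast_ord (esym n1) ord0).
Proof. by subst n; rewrite big_ord1; congr F; apply/val_inj. Qed.

Lemma big_ord_eq0 (V : Type) (idx : V) (op : Monoid.law idx) (n : nat)
    (n0 : n = 0%N) (F : 'I_n -> V) :
  \big[op/idx]_(i < n) F i = idx.
Proof. by subst n; rewrite big_ord0. Qed.

(** * Fusion of Abelian objects and the action of the grades on them *)

Section AbelianFusion.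
Variables (R : realType) (G : groupType) (C : crossed_BTC R G).
Implicit Types a b c d x : C.

Local Notation vac := (vac : C).
Local Notation "k |> a" := (act k%g a) (at level 35, right associativity).

(** Reduces the sum over intermediate charges in a consistency equation to the unique fusion
    channel. *)
Lemma big_sector (V : Type) (idx : V) (op : Monoid.com_law idx) (g : G) c
    (F : C -> V) :
  grade c = g -> (forall d, d != c -> F d = idx) ->
  \big[op/idx]_(d <- sector C g) F d = F c.
Proof.
move=> gc F0; rewrite (bigD1_seq c) /= ?(sector_uniq (cfusion C)) //; last first.
  by rewrite (mem_sector (cfusion C)) gc.
by rewrite big1 ?Monoid.mulm1.
Qed.
Arguments big_sector {V idx op g} c {F}.

Lemma dual_vac : dual vac = vac.
Proof.
have := fus_dual (cfusion C) vac vac; rewrite (fus_vacl (cfusion C)) eqxx.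
by case: eqP.
Qed.

Lemma grade_vac : grade vac = 1%g.
Proof.
have /(grade_fus (cfusion C)) : fus vac vac vac != 0%N.
  by rewrite (fus_vacl (cfusion C)) eqxx.
by rewrite -[X in X = _]mulg1 => /mulgI.
Qed.

Lemma qdim_vac : qdim vac = 1.
Proof.
have e : fus vac vac vac = 1%N by rewrite (fus_vacl (cfusion C)) eqxx.
have := F_vac1 (cassoc C) (cast_ord (esym e) ord0) (cast_ord (esym e) ord0).
by rewrite /qdim dual_vac /= => ->; rewrite normr1 invr1.
Qed.

Lemma qdim_ge0 a : 0 <= qdim a.
Proof. by rewrite /qdim invr_ge0 normr_ge0. Qed.

(* The sum a x dual a contains the vacuum, so (qdim a)^2 >= 1. *)
Lemma qdim_ge1 a : 1 <= qdim a.
Proof.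
rewrite -(@expr_ge1 _ 2) ?qdim_ge0 // expr2.
rewrite -[X in _ * X](qdim_dual (cassoc C)) (qdim_fus (cassoc C)).
have N1 : fus a (dual a) vac = 1%N by rewrite (fus_dual (cfusion C)) eqxx.
rewrite (bigD1_seq vac) /= ?(sector_uniq (cfusion C)) //.
  rewrite N1 qdim_vac mulr1 lerDl sumr_ge0 // => c _.
  by rewrite mulr_ge0 ?qdim_ge0.
by rewrite (mem_sector (cfusion C)) (@grade_fus _ _ _ (cfusion C) a (dual a)) ?N1.
Qed.

Lemma abelian_vac : abelian vac.
Proof. by rewrite /abelian qdim_vac. Qed.

Lemma abelian_dual a : abelian (dual a) = abelian a.
Proof. by rewrite /abelian (qdim_dual (cassoc C)). Qed.

(* All quantum dimensions are at least 1, while those of the constituents of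
   a x b add up to 1. *)
Lemma fus_abelian a b : abelian a -> abelian b ->
  exists2 c, abelian c & forall d, fus a b d = (d == c) :> nat.
Proof.
move=> /eqP da /eqP db; have := qdim_fus (cassoc C) a b.
rewrite da db mul1r => /esym tot.
have Nge0 d : 0 <= (fus a b d)%:R * qdim d by rewrite mulr_ge0 ?qdim_ge0.
have [c cs cN] : exists2 c, c \in sector C (grade a * grade b)%g
                          & fus a b c != 0%N.
  apply/hasP/negPn/negP => /hasPn N0; move: tot; rewrite big_seq big1.
    by move/esym/eqP; rewrite oner_eq0.
  by move=> d /N0; rewrite negbK => /eqP ->; rewrite mul0r.
move: tot; rewrite (bigD1_seq c) /= ?(sector_uniq (cfusion C)) //.
set S := \sum_(_ <- _ | _) _ => tot.
have S0 : 0 <= S by apply: sumr_ge0.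
have Nc1 : 1 <= (fus a b c)%:R :> R[i] by rewrite ler1n lt0n.
have Nd : (fus a b c)%:R * qdim c <= 1 by rewrite -[X in _ <= X]tot lerDl.
have dc : qdim c = 1.
  apply/le_anti; rewrite qdim_ge1 andbT (le_trans _ Nd) //.
  by rewrite ler_peMl ?qdim_ge0.
move: Nd tot; rewrite dc mulr1 => N_le1 tot.
have N1 : fus a b c = 1%N.
  by apply/eqP; rewrite -(eqr_nat R[i]); apply/eqP/le_anti; rewrite N_le1.
have {}S0 : S = 0 by apply: (@addrI _ 1); rewrite addr0 -[RHS]tot N1.
exists c; first by rewrite /abelian dc.
move=> d; have [->|dc_neq] := eqVneq d c; first by [].
have [ds|dNs] := boolP (d \in sector C (grade a * grade b)%g); last first.
  apply/eqP/negPn/negP => /(grade_fus (cfusion C)) gd.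
  by rewrite (mem_sector (cfusion C)) gd eqxx in dNs.
have qd0 : qdim d != 0 by rewrite gt_eqF ?(lt_le_trans ltr01 (qdim_ge1 d)).
have : (fus a b d)%:R * qdim d <= 0.
  rewrite -S0 /S -big_filter (bigD1_seq d) ?filter_uniq ?(sector_uniq (cfusion C)) //=.
    by rewrite lerDl sumr_ge0.
  by rewrite mem_filter dc_neq.
move=> le0; have /eqP : (fus a b d)%:R * qdim d = 0 by apply/le_anti; rewrite le0 Nge0.
by rewrite mulf_eq0 (negPf qd0) orbF pnatr_eq0 => /eqP.
Qed.

(** The filtered list behind [fuse] is nonempty and all its members equal the unique channel of
    [fus_abelian], so its head is that channel and the default [vac] never occurs. *)
Lemma fuse_spec a b : abelian a -> abelian b ->
  abelian (fuse a b) /\ forall c, fus a b c = (c == fuse a b) :> nat.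
Proof.
move=> ha hb; have [c hc Nc] := fus_abelian ha hb.
suff -> : fuse a b = c by [].
have cin : c \in [seq d <- sector C (grade a * grade b)%g | fus a b d != 0%N].
  by rewrite mem_filter (mem_sector (cfusion C))
             (grade_fus (cfusion C) (a := a) (b := b)) Nc !eqxx.
have : fuse a b \in [seq d <- sector C (grade a * grade b)%g | fus a b d != 0%N].
  by rewrite /fuse; case: [seq _ <- _ | _] cin => [//|d s] _; rewrite mem_head.
by rewrite mem_filter Nc; case: (eqVneq (fuse a b) c).
Qed.

Lemma abelian_fuse a b : abelian a -> abelian b -> abelian (fuse a b).
Proof. by move=> ha hb; have [] := fuse_spec ha hb. Qed.

Lemma fusE a b c : abelian a -> abelian b -> fus a b c = (c == fuse a b) :> nat.
Proof. by move=> ha hb; have [_] := fuse_spec ha hb. Qed.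

Lemma fuse_eq a b c : abelian a -> abelian b -> fus a b c != 0%N -> c = fuse a b.
Proof. by move=> ha hb; rewrite fusE //; case: (eqVneq c). Qed.

Lemma fus_fuse a b : abelian a -> abelian b -> fus a b (fuse a b) = 1%N.
Proof. by move=> ha hb; rewrite fusE // eqxx. Qed.

Lemma fusN a b c : abelian a -> abelian b -> c != fuse a b -> fus a b c = 0%N.
Proof. by move=> ha hb /negPf cN; rewrite fusE // cN. Qed.

Lemma grade_fuse a b : abelian a -> abelian b ->
  grade (fuse a b) = (grade a * grade b)%g.
Proof. by move=> ha hb; apply: (grade_fus (cfusion C)); rewrite fus_fuse. Qed.

Lemma fuse_vacl a : abelian a -> fuse vac a = a.
Proof.
move=> ha; apply/esym/fuse_eq => //; first exact: abelian_vac.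
by rewrite (fus_vacl (cfusion C)) eqxx.
Qed.

Lemma fuse_vacr a : abelian a -> fuse a vac = a.
Proof.
move=> ha; apply/esym/fuse_eq => //; first exact: abelian_vac.
by rewrite (fus_vacr (cfusion C)) eqxx.
Qed.

Lemma fuse_dualr a : abelian a -> fuse a (dual a) = vac.
Proof.
move=> ha; apply/esym/fuse_eq; rewrite ?abelian_dual //.
by rewrite (fus_dual (cfusion C)) eqxx.
Qed.

Lemma fuse_duall a : abelian a -> fuse (dual a) a = vac.
Proof.
move=> ha; apply/esym/fuse_eq; rewrite ?abelian_dual //.
by rewrite (fus_dual (cfusion C)) (dualK (cfusion C)) eqxx.
Qed.

(** At total charge (ab)c the left sum of [fusA] is 1 and the right one has only the channel bc, so
    a x bc must contain (ab)c. *)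
Lemma fuseA a b c : abelian a -> abelian b -> abelian c ->
  fuse a (fuse b c) = fuse (fuse a b) c.
Proof.
move=> ha hb hc; have hab := abelian_fuse ha hb; have hbc := abelian_fuse hb hc.
apply/esym/fuse_eq => //.
have := fusA (cfusion C) a b c (fuse (fuse a b) c).
rewrite (big_sector (fuse a b)) ?grade_fuse //; last first.
  by move=> d dN; rewrite fusN.
rewrite (big_sector (fuse b c)) ?grade_fuse //; last first.
  by move=> d dN; rewrite fusN.
by rewrite !fus_fuse // !mul1n => <-.
Qed.

Lemma grade_dual a : abelian a -> grade (dual a) = (grade a)^-1%g.
Proof.
move=> ha; apply/esym/mulg1_eq.
by rewrite -grade_fuse ?abelian_dual // fuse_dualr // grade_vac.
Qed.

(* Multiply a x y on the left by dual a. *)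
Lemma fus_eqVl a y c : abelian a -> abelian c -> fus a y c != 0%N ->
  y = fuse (dual a) c.
Proof.
move=> ha hc Nc; have had : abelian (dual a) by rewrite abelian_dual.
have := fusA (cfusion C) (dual a) a y (fuse (dual a) c).
rewrite (big_sector vac) /=; last 2 first.
- by rewrite grade_vac grade_dual // mulVg.
- by move=> d dN; rewrite fusN // fuse_duall.
rewrite -[X in fus (dual a) a X](fuse_duall ha) fus_fuse // mul1n (fus_vacl (cfusion C)).
(* If y differed from the claimed product, the left side would vanish, while the channel [c]
   contributes [fus a y c], which is nonzero, on the right. *)
case: eqVneq => [//|_] /esym/eqP.
rewrite (bigD1_seq c) /= ?(sector_uniq (cfusion C)) //; last first.
  by rewrite (mem_sector (cfusion C)) (grade_fus (cfusion C) Nc).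
by rewrite fus_fuse // muln1 addn_eq0 (negPf Nc).
Qed.

Lemma actV (k : G) a : k |> a = a -> k^-1 |> a = a.
Proof.
by move=> ka; rewrite -[X in _ |> X]ka -(act_mul (caction C)) mulVg (act_one (caction C)).
Qed.

Lemma actX (k : G) a (n : nat) : k |> a = a -> (k ^+ n) |> a = a.
Proof.
move=> ka; elim: n => [|n IHn]; first by rewrite expg0 (act_one (caction C)).
by rewrite expgS (act_mul (caction C)) IHn.
Qed.

Lemma act_fuse (k : G) a b : abelian a -> abelian b ->
  k |> a = a -> k |> b = b -> k |> fuse a b = fuse a b.
Proof.
move=> ha hb ka kb; apply: fuse_eq => //.
by rewrite -{1}ka -{1}kb (fus_act (caction C)) fus_fuse.
Qed.

Lemma fuseC a b : abelian a -> abelian b -> grade b |> a = a ->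
  fuse a b = fuse b a.
Proof.
move=> ha hb /actV ba; apply: fuse_eq => //.
by rewrite -{1}ba -(fusC (cbraiding C)) fus_fuse.
Qed.

(** The crossed braiding turns a x b into b times the translate of a, and b can be cancelled. The
    translate is not yet known to be Abelian, which [fus_eqVl] does not ask of its second factor. *)
Lemma act_fuseC a b : abelian a -> abelian b -> fuse a b = fuse b a ->
  grade b |> a = a.
Proof.
move=> ha hb ab; suff /actV : (grade b)^-1 |> a = a by rewrite invgK.
have Nc : fus b ((grade b)^-1 |> a) (fuse a b) != 0%N.
  by rewrite -(fusC (cbraiding C)) fus_fuse.
rewrite (fus_eqVl hb (abelian_fuse ha hb) Nc) ab fuseA ?abelian_dual //.
by rewrite fuse_duall // fuse_vacl.
Qed.

End AbelianFusion.

Arguments big_sector {R G C V idx op g} c {F}.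

(** * The consistency equations restricted to Abelian objects *)

Section AbelianSkeleton.
Variables (R : realType) (G : groupType) (C : crossed_BTC R G).
Implicit Types a b c d x : C.

Local Notation vac := (vac : C).
Local Notation "k |> a" := (act k%g a) (at level 35, right associativity).

(** The total charge is bracketed as a(bc); the vertex joining ab to c needs the other bracketing,
    supplied by [fuseA]. *)
Definition Fabelian a b c : R[i] :=
  Fsym a b c (fuse a (fuse b c)) (fuse a b) 0 0 (fuse b c) 0 0.

Definition Uabelian (k : G) a b : R[i] := Usym k a b (fuse a b) 0 0.

Let ord1 (n : nat) (n1 : n = 1%N) : 'I_n := cast_ord (esym n1) ord0.

Lemma normCK_neq0 (z : R[i]) : z * z^* = 1 -> z != 0.
Proof. by move=> z1; apply/eqP => z0; move/eqP: z1; rewrite z0 mul0r eq_sym oner_eq0. Qed.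

Lemma RabelianK a b : abelian a -> abelian b ->
  Rabelian a b * (Rabelian a b)^* = 1.
Proof.
move=> ha hb; have N1 := fus_fuse ha hb.
have := R_unitary (cbraiding C) (ord1 N1) (ord1 N1).
by rewrite (big_ord_eq1 _ N1) eqxx.
Qed.

Lemma Rabelian_neq0 a b : abelian a -> abelian b -> Rabelian a b != 0.
Proof. by move=> ha hb; apply/normCK_neq0/RabelianK. Qed.

Lemma Uabelian_neq0 (k : G) a b : abelian a -> abelian b -> Uabelian k a b != 0.
Proof.
move=> ha hb; have N1 := fus_fuse ha hb; apply: normCK_neq0.
have := U_unitary (caction C) k (ord1 N1) (ord1 N1).
by rewrite (big_ord_eq1 _ N1) eqxx.
Qed.

Lemma Uabelian1 a b : abelian a -> abelian b -> Uabelian 1%g a b = 1.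
Proof.
move=> ha hb; have N1 := fus_fuse ha hb.
by have := U_one (caction C) (ord1 N1) (ord1 N1); rewrite eqxx.
Qed.

Lemma Fabelian_neq0 a b c : abelian a -> abelian b -> abelian c ->
  Fabelian a b c != 0.
Proof.
move=> ha hb hc; have hab := abelian_fuse ha hb; have hbc := abelian_fuse hb hc.
have Nab := fus_fuse ha hb; have Nbc := fus_fuse hb hc.
have Nabc : fus (fuse a b) c (fuse a (fuse b c)) = 1%N by rewrite fuseA ?fus_fuse.
apply: normCK_neq0.
have := F_unitaryl (cassoc C) (ord1 Nab) (ord1 Nabc) (ord1 Nab) (ord1 Nabc).
rewrite !eqxx (big_sector (fuse b c)) ?grade_fuse //; last first.
  by move=> d dN; rewrite (big_ord_eq0 _ (fusN hb hc dN)).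
by rewrite (big_ord_eq1 _ Nbc) (big_ord_eq1 _ (fus_fuse ha hbc)) !mul1r.
Qed.

Lemma eta_neq0 x (g h : G) : etasym x g h != 0.
Proof. by rewrite -normr_eq0 (eta_phase (caction C)) oner_eq0. Qed.

Section Heptagons.
Variables a b c : C.
Hypotheses (ha : abelian a) (hb : abelian b) (hc : abelian c).
Hypotheses (ac : fuse a c = fuse c a) (bc : fuse b c = fuse c b).

Let hab := abelian_fuse ha hb.
Let hbc := abelian_fuse hb hc.
Let hca := abelian_fuse hc ha.

(** One total charge occurs in several bracketings. These facts show that each fusion space in the
    heptagons is one-dimensional, in the bracketing used there. *)
Let d_ca_b : fuse a (fuse b c) = fuse (fuse c a) b.
Proof. by rewrite -ac bc fuseA. Qed.

Let d_ab_c : fuse a (fuse b c) = fuse (fuse a b) c.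
Proof. by rewrite fuseA. Qed.

Let d_c_ab : fuse a (fuse b c) = fuse c (fuse a b).
Proof. by rewrite d_ca_b fuseA. Qed.

Let N_ca : fus c a (fuse c a) = 1%N. Proof. exact: fus_fuse. Qed.
Let N_ac : fus a c (fuse c a) = 1%N. Proof. by rewrite -ac fus_fuse. Qed.
Let N_bc : fus b c (fuse b c) = 1%N. Proof. exact: fus_fuse. Qed.
Let N_cb : fus c b (fuse b c) = 1%N. Proof. by rewrite bc fus_fuse. Qed.
Let N_ab : fus a b (fuse a b) = 1%N. Proof. exact: fus_fuse. Qed.
Let N_cab : fus (fuse c a) b (fuse a (fuse b c)) = 1%N.
Proof. by rewrite d_ca_b fus_fuse. Qed.
Let N_a_bc : fus a (fuse b c) (fuse a (fuse b c)) = 1%N.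
Proof. exact: fus_fuse. Qed.
Let N_ab_c : fus (fuse a b) c (fuse a (fuse b c)) = 1%N.
Proof. by rewrite d_ab_c fus_fuse. Qed.
Let N_c_ab : fus c (fuse a b) (fuse a (fuse b c)) = 1%N.
Proof. by rewrite d_c_ab fus_fuse. Qed.

Lemma heptagon_over_abelian :
  Rabelian a c * Fabelian a c b * Rabelian b c
  = Fabelian c a b * Uabelian (grade c) a b * Rabelian (fuse a b) c
    * Fabelian a b c.
Proof.
(* Commuting under fusion with [c] means being fixed by its grade, so the translated labels of the
   heptagon become a, b and ab. *)
have ca := act_fuseC ha hc ac; have cb := act_fuseC hb hc bc.
have cab := actV (act_fuse ha hb ca cb).
have := heptagon_over (cbraiding C) (a := a) (b := b) (c := c)
  (d := fuse a (fuse b c)) (e := fuse c a) (f := fuse b c).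
rewrite /= (actV ca) (actV cb).
move=> /(_ (ord1 N_ca) (ord1 N_cab) (ord1 N_bc) (ord1 N_a_bc)).
rewrite (big_ord_eq1 _ N_ac) (big_ord_eq1 _ N_cb).
rewrite (big_sector (fuse a b)) ?grade_fuse //; last first.
  move=> d dN; rewrite big1 // => i _; rewrite big1 // => j _.
  by rewrite (big_ord_eq0 _ (fusN ha hb dN)).
rewrite cab (big_ord_eq1 _ N_ab) (big_ord_eq1 _ N_c_ab) (big_ord_eq1 _ N_ab).
rewrite (big_ord_eq1 _ N_ab_c) /=.
by rewrite /Rabelian /Fabelian /Uabelian -d_ab_c -d_c_ab -bc ac.
Qed.

Lemma heptagon_under_abelian :
  (Rabelian c a)^* * Fabelian a c b * (Rabelian c b)^*
  = Fabelian c a b * etasym c (grade a) (grade b) * (Rabelian c (fuse a b))^*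
    * Fabelian a b c.
Proof.
have Ac := actV (act_fuseC hc ha (esym ac)).
have Bc := actV (act_fuseC hc hb (esym bc)).
have := heptagon_under (cbraiding C) (a := a) (b := b) (c := c)
  (d := fuse a (fuse b c)) (e := fuse c a) (f := fuse b c).
rewrite /= (act_mul (caction C)) Ac Bc.
move=> /(_ (ord1 N_ca) (ord1 N_cab) (ord1 N_bc) (ord1 N_a_bc)).
rewrite (big_ord_eq1 _ N_ac) (big_ord_eq1 _ N_cb).
rewrite (big_sector (fuse a b)) ?grade_fuse //; last first.
  by move=> d dN; rewrite (big_ord_eq0 _ (fusN ha hb dN)).
rewrite (big_ord_eq1 _ N_ab) (big_ord_eq1 _ N_c_ab) (big_ord_eq1 _ N_ab_c) /=.
by rewrite /Rinv /Rabelian /Fabelian -d_c_ab -bc ac.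
Qed.

(* The F-symbols cancel between the two heptagon equations. *)
Lemma mutual_stat_fuse :
  mutual_stat (fuse a b) c * Uabelian (grade c) a b
  = mutual_stat a c * mutual_stat b c * etasym c (grade a) (grade b).
Proof.
have over := heptagon_over_abelian; have under := heptagon_under_abelian.
have Ka := RabelianK hc ha; have Kb := RabelianK hc hb.
have Kab := RabelianK hc hab.
have F1 := Fabelian_neq0 hc ha hb; have F2 := Fabelian_neq0 ha hb hc.
rewrite /mutual_stat; apply: (mulfI (mulf_neq0 F1 F2)).
(* By unitarity the conjugates are inverses; multiplying by the three R-phases clears them. *)
have {}under : Fabelian a c b * Rabelian c (fuse a b) = Rabelian c a * Rabelian c b
    * Fabelian c a b * etasym c (grade a) (grade b) * Fabelian a b c.
  transitivity (Rabelian c a * Rabelian c b * Rabelian c (fuse a b)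
    * ((Rabelian c a)^* * Fabelian a c b * (Rabelian c b)^*)).
    transitivity ((Rabelian c a * (Rabelian c a)^*) * (Rabelian c b * (Rabelian c b)^*)
      * (Fabelian a c b * Rabelian c (fuse a b))); first by rewrite Ka Kb !mul1r.
    by ring.
  rewrite under.
  transitivity ((Rabelian c (fuse a b) * (Rabelian c (fuse a b))^*) * (Rabelian c a
    * Rabelian c b * Fabelian c a b * etasym c (grade a) (grade b) * Fabelian a b c)).
    by ring.
  by rewrite Kab mul1r.
(* Both sides are compared with this product: the first heptagon rewrites it into the left side, the
   second into the right side. *)
transitivity ((Rabelian a c * Fabelian a c b * Rabelian b c) * Rabelian c (fuse a b)).
  by rewrite over; ring.
transitivity (Rabelian a c * Rabelian b c * (Fabelian a c b * Rabelian c (fuse a b))).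
  by ring.
by rewrite under; ring.
Qed.

End Heptagons.

Lemma twist_abelian a : abelian a -> twist a = Rabelian a a.
Proof.
move=> ha; rewrite /twist (big_sector (fuse a a)) ?grade_fuse //; last first.
  by move=> d dN; rewrite (big_ord_eq0 _ (fusN ha ha dN)).
rewrite (big_ord_eq1 _ (fus_fuse ha ha)) /=.
by rewrite (eqP ha) (eqP (abelian_fuse ha ha)) divr1 mul1r.
Qed.

Lemma twist_neq0 a : abelian a -> twist a != 0.
Proof. by move=> ha; rewrite twist_abelian // Rabelian_neq0. Qed.

Lemma mutual_stat_diag a : abelian a -> mutual_stat a a = twist a ^+ 2.
Proof. by move=> ha; rewrite twist_abelian. Qed.

Lemma mutual_statC a b : mutual_stat a b = mutual_stat b a.
Proof. exact: mulrC. Qed.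

Lemma ribbon_abelian a b : abelian a -> abelian b -> fuse a b = fuse b a ->
  twist (fuse a b) * Uabelian (grade a * grade b)%g a b
  = mutual_stat a b * twist a * twist b
    * etasym a (grade a) (grade b) * etasym b (grade b) (grade a).
Proof.
move=> ha hb ab; have N1 := fus_fuse ha hb.
have gab : (grade a * grade b = grade b * grade a)%g.
  by rewrite -!grade_fuse // ab.
have := ribbon (cbraiding C) (ord1 N1) (ord1 N1).
(* Since a and b commute under fusion, their grades commute and that of b fixes a, so the conjugated
   grade and the translated label disappear. *)
rewrite /= (big_ord_eq1 _ N1) /= -mulgA gab mulKg (actV (act_fuseC ha hb ab)).
rewrite /mutual_stat /Rabelian /Uabelian -ab => E.
rewrite [X in _ = X * _ * _ * _ * _]mulrC E.
have ta := twist_neq0 ha; have tb := twist_neq0 hb.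
have ea := eta_neq0 a (grade a) (grade b); have eb := eta_neq0 b (grade b) (grade a).
by field; rewrite ea eb ta tb.
Qed.

Lemma eta_fuse (k l : G) a b : abelian a -> abelian b ->
  k |> a = a -> k |> b = b ->
  etasym a k l * etasym b k l * (Uabelian l a b * Uabelian k a b)
  = Uabelian (k * l)%g a b * etasym (fuse a b) k l.
Proof.
move=> ha hb ka kb; have N1 := fus_fuse ha hb.
have kab := act_fuse ha hb ka kb.
have := eta_U (caction C) k l (ord1 N1) (ord1 N1).
by rewrite (big_ord_eq1 _ N1) (actV ka) (actV kb) (actV kab).
Qed.

End AbelianSkeleton.

(** * Powers of an Abelian defect: their eta-phases, braidings and twists *)

Section Powers.
Variables (R : realType) (G : groupType) (C : crossed_BTC R G).
Implicit Types a b c x : C.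

Local Notation vac := (vac : C).
Local Notation "k |> a" := (act k%g a) (at level 35, right associativity).

(** Equivariance of fusion makes the image of [vac] fuse with [vac] to [vac], and fusion with [vac]
    on the right preserves the other factor. *)
Lemma act_vac (k : G) : k |> vac = vac.
Proof.
have := fus_act (caction C) k vac (k^-1 |> vac) (k^-1 |> vac).
rewrite -(act_mul (caction C)) mulgV (act_one (caction C)).
rewrite (fus_vacl (cfusion C)) (fus_vacr (cfusion C)) eqxx.
by case: eqP.
Qed.

Lemma Rabelian_vacl a : abelian a -> Rabelian vac a = 1.
Proof. by move=> ha; rewrite /Rabelian fuse_vacl // (R_vacl (cbraiding C)). Qed.

Lemma Rabelian_vacr a : abelian a -> Rabelian a vac = 1.
Proof. by move=> ha; rewrite /Rabelian fuse_vacr // (R_vacr (cbraiding C)). Qed.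

Lemma mutual_stat_vacl a : abelian a -> mutual_stat vac a = 1.
Proof. by move=> ha; rewrite /mutual_stat Rabelian_vacl // Rabelian_vacr ?mulr1. Qed.

Lemma fexpnS x (n : nat) : fexpn x n.+1 = fuse x (fexpn x n).
Proof. by []. Qed.

Lemma abelian_fexpn x (n : nat) : abelian x -> abelian (fexpn x n).
Proof.
by move=> hx; elim: n => [|n IHn]; [exact: abelian_vac | exact: abelian_fuse].
Qed.

Lemma grade_fexpn x (n : nat) : abelian x ->
  grade (fexpn x n) = (grade x ^+ n)%g.
Proof.
move=> hx; elim: n => [|n IHn]; first by rewrite grade_vac expg0.
by rewrite expgS -IHn -grade_fuse // abelian_fexpn.
Qed.

Lemma act_fexpn (k : G) x (n : nat) : abelian x -> k |> x = x ->
  k |> fexpn x n = fexpn x n.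
Proof.
move=> hx kx; elim: n => [|n IHn]; first exact: act_vac.
by rewrite /fexpn iterS act_fuse ?abelian_fexpn.
Qed.

Lemma eta_fexpn (k l : G) x (n : nat) : abelian x -> k |> x = x ->
  etasym (fexpn x n) k l * \prod_(i < n) Uabelian (k * l)%g x (fexpn x i)
  = etasym x k l ^+ n * ((\prod_(i < n) Uabelian l x (fexpn x i))
                         * \prod_(i < n) Uabelian k x (fexpn x i)).
Proof.
move=> hx kx; elim: n => [|n IHn].
  by rewrite !big_ord0 (eta_vac (caction C)) expr0 !mul1r.
have hn := abelian_fexpn n hx.
have := eta_fuse l hx hn kx (act_fexpn n hx kx).
rewrite fexpnS !big_ord_recr exprS /= => E; move: IHn.
set A := \prod_(i < n) _; set B := \prod_(i < n) _; set D := \prod_(i < n) _ => IHn.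
rewrite mulrCA [X in _ * X]mulrC -E.
transitivity (etasym x k l * (etasym (fexpn x n) k l * A)
              * (Uabelian l x (fexpn x n) * Uabelian k x (fexpn x n))); first by ring.
by rewrite IHn; ring.
Qed.

(** The U-products in [eta_fexpn] are symmetric under exchanging commuting k and l, so they drop out
    of the ratio. *)
Lemma eta_commutator_fexpn (k l : G) x (n : nat) : abelian x ->
  k |> x = x -> l |> x = x -> (k * l = l * k)%g ->
  etasym (fexpn x n) k l / etasym (fexpn x n) l k
  = (etasym x k l / etasym x l k) ^+ n.
Proof.
move=> hx kx lx kl; rewrite expr_div_n; apply/eqP; rewrite eqr_div ?expf_neq0 ?eta_neq0 //.
have := eta_fexpn l n hx kx; have := eta_fexpn k n hx lx; rewrite -kl.
set A := \prod_(i < n) _; set B := \prod_(i < n) _; set D := \prod_(i < n) _.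
have U0 h : \prod_(i < n) Uabelian h x (fexpn x i) != 0.
  by apply/prodf_neq0 => i _; rewrite Uabelian_neq0 ?abelian_fexpn.
move=> E1 E2; apply/eqP/(mulIf (mulf_neq0 (U0 (k * l)%g) (mulf_neq0 (U0 k) (U0 l)))).
rewrite -/A -/B -/D.
transitivity ((etasym (fexpn x n) k l * A) * (etasym x l k ^+ n * (B * D))); first by ring.
by rewrite E2 -E1; ring.
Qed.

Section Twist.
Variable x : C.
Hypothesis hx : abelian x.
Let g := grade x.
Let eta (i : nat) := etasym x g (g ^+ i)%g.

Let gx (i : nat) : (g ^+ i) |> x = x.
Proof. by apply: actX; rewrite (act_self (caction C)). Qed.

Lemma fuse_fexpnC (i : nat) : fuse x (fexpn x i) = fuse (fexpn x i) x.
Proof. by rewrite fuseC ?abelian_fexpn // grade_fexpn. Qed.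

(** Since g fixes x, the cocycle law at (g, g^i, g) carries the symmetry from i to i + 1. *)
Lemma eta_gradeXC (i : nat) : etasym x (g ^+ i)%g g = eta i.
Proof.
rewrite /eta; elim: i => [|i IHi].
  by rewrite expg0 (eta_1l (caction C)) (eta_1r (caction C)).
have := eta_cocycle (caction C) x g (g ^+ i)%g g.
rewrite (actV (act_self (caction C) x)) -expgS -expgSr IHi.
by apply: mulfI; rewrite eta_neq0.
Qed.

(** Each further factor x contributes M(x,x), the square of its twist, and one phase [eta n] through
    [mutual_stat_fuse]. *)
Lemma mutual_stat_fexpn (n : nat) :
  mutual_stat (fexpn x n) x * \prod_(i < n) Uabelian g x (fexpn x i)
  = twist x ^+ (2 * n) * \prod_(i < n) eta i.
Proof.
elim: n => [|n IHn].
  by rewrite !big_ord0 mutual_stat_vacl // muln0 expr0.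
rewrite fexpnS !big_ord_recr /= mulrA mulrAC.
have := mutual_stat_fuse hx (abelian_fexpn n hx) hx (erefl _) (esym (fuse_fexpnC n)).
rewrite grade_fexpn // -/g mutual_stat_diag // => ->.
rewrite mulnSr exprD /eta; move: IHn; rewrite /eta.
set A := \prod_(i < n) _; set B := \prod_(i < n) _ => IHn.
transitivity (twist x ^+ 2 * (mutual_stat (fexpn x n) x * A)
  * etasym x g (g ^+ n)%g); first by ring.
by rewrite IHn; ring.
Qed.

(* The product of U-phases on the left is 1 once g^n = 1. *)
Lemma twist_fexpn_U (n : nat) :
  twist (fexpn x n) * \prod_(i < n) Uabelian (g ^+ n)%g x (fexpn x i)
  = twist x ^+ (n * n) * (\prod_(i < n) eta i) ^+ n.
Proof.
elim: n => [|n IHn].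
  by rewrite big_ord0 /= mulr1 expr0 mul1r twist_abelian ?Rabelian_vacl ?abelian_vac.
have rib := ribbon_abelian hx (abelian_fexpn n hx) (fuse_fexpnC n).
have mon := mutual_stat_fexpn n.
have := eta_fexpn g n hx (gx n); rewrite eta_gradeXC -expgSr => et.
rewrite grade_fexpn // -/g -expgS -/(eta n) in rib.
rewrite fexpnS !big_ord_recr /= mulrCA rib mulrC.
move: IHn mon et; set A := \prod_(i < n) _; set B := \prod_(i < n) _.
set D := \prod_(i < n) _; set E := \prod_(i < n) _ => IHn mon et.
transitivity (mutual_stat x (fexpn x n) * twist x * eta n * twist (fexpn x n)
  * (etasym (fexpn x n) (g ^+ n)%g g * E)); first by ring.
(* [eta_fexpn] trades the U-product at g^(n+1) for those at g and g^n, which are absorbed by the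
   braiding formula and the induction hypothesis. *)
rewrite et mutual_statC.
transitivity ((mutual_stat (fexpn x n) x * D) * twist x * (eta n * eta n ^+ n)
  * (twist (fexpn x n) * A)); first by ring.
(* The summand 2n comes from the braiding of x^n with x, 1 from the twist of x in the ribbon
   property, and n^2 from the induction hypothesis. *)
have -> : (n.+1 * n.+1 = 2 * n + 1 + n * n)%N by ring.
by rewrite mon IHn !exprD expr1 exprMn !exprS; ring.
Qed.

Lemma twist_fexpn (n : nat) : (g ^+ n)%g = 1%g ->
  twist (fexpn x n) = Iinv n x ^+ n.
Proof.
move=> gn; have := twist_fexpn_U n; rewrite gn big1 ?mulr1.
  by rewrite /Iinv exprMn -exprM => ->.
by move=> i _; rewrite Uabelian1 // abelian_fexpn.
Qed.

End Twist.
End Powers.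

(** * The group of Abelian anyons, its braiding characters, and the defect cocycle *)

Section AbelianAnyons.
Variables (R : realType) (G : groupType) (C : crossed_BTC R G).
Implicit Types a b c x : C.

Local Notation vac := (vac : C).
Local Notation "k |> a" := (act k%g a) (at level 35, right associativity).

Lemma fuse_anyonC a b : abelian a -> abelian_anyon b -> fuse a b = fuse b a.
Proof.
by move=> ha /andP[/eqP gb hb]; apply: fuseC; rewrite // gb (act_one (caction C)).
Qed.

Lemma abelian_anyon_vac : abelian_anyon vac.
Proof. by rewrite /abelian_anyon /anyon grade_vac eqxx abelian_vac. Qed.

Lemma abelian_anyon_fuse a b :
  abelian_anyon a -> abelian_anyon b -> abelian_anyon (fuse a b).
Proof.
move=> /andP[/eqP ga ha] /andP[/eqP gb hb].
by rewrite /abelian_anyon /anyon grade_fuse // ga gb mulg1 eqxx abelian_fuse.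
Qed.

Lemma abelian_anyon_dual a : abelian_anyon a -> abelian_anyon (dual a).
Proof.
move=> /andP[/eqP ga ha].
by rewrite /abelian_anyon /anyon grade_dual // ga invg1 eqxx abelian_dual.
Qed.

(** A subtype, so that the fusion group becomes a Z-module and identities between fusion products
    become additive ones. *)
Definition abelian_anyons : Type := {a : C | abelian_anyon a}.

HB.instance Definition _ := Choice.on abelian_anyons.

Definition anyon_zero : abelian_anyons := Sub _ abelian_anyon_vac.
Definition anyon_opp (a : abelian_anyons) : abelian_anyons :=
  Sub _ (abelian_anyon_dual (valP a)).
Definition anyon_add (a b : abelian_anyons) : abelian_anyons :=
  Sub _ (abelian_anyon_fuse (valP a) (valP b)).

Let abel (a : abelian_anyons) : abelian (val a).
Proof. by have /andP[] := valP a. Qed.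

Fact anyon_addA : associative anyon_add.
Proof. by move=> a b c; apply: val_inj; rewrite /= fuseA ?abel. Qed.

Fact anyon_addC : commutative anyon_add.
Proof.
by move=> a b; apply: val_inj; rewrite /= fuse_anyonC ?abel ?(valP b).
Qed.

Fact anyon_add0 : left_id anyon_zero anyon_add.
Proof. by move=> a; apply: val_inj; rewrite /= fuse_vacl ?abel. Qed.

Fact anyon_addN : left_inverse anyon_zero anyon_opp anyon_add.
Proof. by move=> a; apply: val_inj; rewrite /= fuse_duall ?abel. Qed.

HB.instance Definition _ := GRing.isZmodule.Build abelian_anyons
  anyon_addA anyon_addC anyon_add0 anyon_addN.

Lemma val_anyon_muln (a : abelian_anyons) (n : nat) :
  val (a *+ n) = fexpn (val a) n.
Proof. by elim: n => [//|n IHn]; rewrite mulrS fexpnS -IHn. Qed.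

Lemma val_anyon_mulz (a : abelian_anyons) (z : int) :
  val (a *~ z) = fexpz (val a) z.
Proof.
case: z => n; first by rewrite -pmulrn val_anyon_muln.
by rewrite NegzE mulrNz -pmulrn -mulNrn val_anyon_muln.
Qed.

(** The trivial grade of [c] makes U trivial in [mutual_stat_fuse], and that of [a] makes eta
    trivial. *)
Lemma mutual_stat_anyonDl (a b : abelian_anyons) c : abelian_anyon c ->
  mutual_stat (val (a + b)) c = mutual_stat (val a) c * mutual_stat (val b) c.
Proof.
move=> hc; have /andP[/eqP gc cab] := hc.
have := mutual_stat_fuse (abel a) (abel b) cab (fuse_anyonC (abel a) hc)
  (fuse_anyonC (abel b) hc).
have /andP[/eqP -> _] := valP a.
by rewrite gc Uabelian1 // (eta_1l (caction C)) !mulr1.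
Qed.

Lemma mutual_stat_neq0 a b : abelian a -> abelian b -> mutual_stat a b != 0.
Proof. by move=> ha hb; rewrite mulf_neq0 // Rabelian_neq0. Qed.

Lemma mutual_stat_anyonN (a : abelian_anyons) c : abelian_anyon c ->
  mutual_stat (val (- a)) c = (mutual_stat (val a) c)^-1.
Proof.
move=> hc; have /andP[_ cab] := hc.
apply: (mulIf (mutual_stat_neq0 (abel a) cab)).
by rewrite -mutual_stat_anyonDl // addNr mulVf ?mutual_stat_neq0 // mutual_stat_vacl.
Qed.

Lemma mutual_stat_fexpz a c (z : int) : abelian_anyon a -> abelian_anyon c ->
  mutual_stat (fexpz a z) c = mutual_stat a c ^ z.
Proof.
move=> ha hc; have /andP[_ cab] := hc; pose A : abelian_anyons := Sub a ha.
have nat_case n : mutual_stat (val (A *+ n)) c = mutual_stat a c ^+ n.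
  elim: n => [|n IHn]; first by rewrite mutual_stat_vacl.
  by rewrite mulrS mutual_stat_anyonDl // IHn exprS.
rewrite -[a in fexpz a]/(val A) -val_anyon_mulz.
case: z => n; first by rewrite -pmulrn nat_case.
by rewrite NegzE mulrNz -pmulrn mutual_stat_anyonN // nat_case.
Qed.

Lemma fuse_dual_eq_vac a b : abelian a -> abelian b ->
  fuse a (dual b) = vac -> a = b.
Proof.
move=> ha hb e; have hd : abelian (dual b) by rewrite abelian_dual.
rewrite -[a]fuse_vacr // -(fuse_duall hb) fuseA // e.
by rewrite fuse_vacl.
Qed.

Section DefectCocycle.
Variables (zero : G -> C) (w : G -> G -> C).
Hypotheses (zeroP : abelian_defect_choice zero) (wP : defect_cocycle zero w).

Let hz k : abelian (zero k). Proof. by have [_ /(_ k)[]] := zeroP. Qed.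
Let gz k : grade (zero k) = k. Proof. by have [_ /(_ k)[]] := zeroP. Qed.
Let hw k l : abelian_anyon (w k l). Proof. by have [] := wP k l. Qed.
Let hwa k l : abelian (w k l). Proof. by have /andP[] := hw k l. Qed.
Let zz k l : fuse (zero k) (zero l) = fuse (w k l) (zero (k * l)%g).
Proof. by have [] := wP k l. Qed.

(** Both decompositions of 0_k x 0_l are braided with [c]; the one through [w k l] has trivial eta
    because [w k l] is an anyon. *)
Lemma mutual_stat_eta_zero c (k l : G) : abelian_anyon c ->
  mutual_stat (w k l) c * mutual_stat (zero (k * l)%g) c
  = mutual_stat (zero k) c * mutual_stat (zero l) c * etasym c k l.
Proof.
move=> hc; have /andP[/eqP gc cab] := hc.
have anC a : abelian a -> fuse a c = fuse c a by move=> ha; rewrite fuse_anyonC.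
have := mutual_stat_fuse (hz k) (hz l) cab (anC _ (hz k)) (anC _ (hz l)).
rewrite gc Uabelian1 // mulr1 !gz zz => <-.
have /andP[/eqP gw _] := hw k l.
have := mutual_stat_fuse (hwa k l) (hz (k * l)%g) cab (anC _ (hwa k l)) (anC _ (hz _)).
by rewrite gc Uabelian1 // mulr1 gw (eta_1l (caction C)) mulr1 => ->.
Qed.

(* c detects the commutator of the fractionalization cocycle by braiding. *)
Lemma eta_commutator_anyon c (k l : G) : abelian_anyon c -> (k * l = l * k)%g ->
  etasym c k l / etasym c l k = mutual_stat (fuse (w k l) (dual (w l k))) c.
Proof.
move=> hc kl; have /andP[_ cab] := hc.
pose A : abelian_anyons := Sub _ (hw k l); pose B : abelian_anyons := Sub _ (hw l k).
rewrite -[fuse _ _]/(val (A - B)) mutual_stat_anyonDl // mutual_stat_anyonN //.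
have E1 := mutual_stat_eta_zero k l hc; have E2 := mutual_stat_eta_zero l k hc.
apply/eqP; rewrite eqr_div ?eta_neq0 ?mutual_stat_neq0 //; apply/eqP.
apply: (mulfI (mutual_stat_neq0 (hz (k * l)%g) cab)).
apply: (mulfI (mutual_stat_neq0 (hz k) cab)).
apply: (mulfI (mutual_stat_neq0 (hz l) cab)).
transitivity ((mutual_stat (zero k) c * mutual_stat (zero l) c * etasym c k l)
  * (mutual_stat (w l k) c * mutual_stat (zero (l * k)%g) c)).
  by rewrite -kl /=; ring.
by rewrite -E1 E2 /=; ring.
Qed.

(* x is an anyon times 0_g, so it commutes with 0_k as soon as 0_g does. *)
Lemma act_defect x (k : G) : abelian x -> (grade x * k = k * grade x)%g ->
  w (grade x) k = w k (grade x) -> k |> x = x.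
Proof.
move=> hx; set g := grade x => gk wgk.
suff /(act_fuseC hx (hz k)) : fuse x (zero k) = fuse (zero k) x by rewrite gz.
have hdz : abelian (dual (zero g)) by rewrite abelian_dual.
pose y := fuse x (dual (zero g)); have hy : abelian y by rewrite abelian_fuse.
have xE : x = fuse y (zero g) by rewrite -fuseA // fuse_duall ?fuse_vacr.
have any_y : abelian_anyon y.
  by rewrite /abelian_anyon hy andbT /anyon grade_fuse // grade_dual // gz mulgV.
rewrite xE -fuseA // zz wgk gk -zz fuseA // -(fuse_anyonC (hz k) any_y).
by rewrite -fuseA.
Qed.

End DefectCocycle.
End AbelianAnyons.

(** * Phases and commutators in the magnetic translation group *)

Section MagneticTranslationGroup.
Variable R : realType.

Lemma e2piN (x : R) : e2pi (- x) = (e2pi x)^-1.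
Proof.
have x0 : e2pi x != 0 by rewrite -normr_eq0 norm_e2pi oner_eq0.
by apply: (mulIf x0); rewrite -e2piD addNr e2pi0 mulVf.
Qed.

Lemma e2pi_mulz (z : int) (x : R) : e2pi (z%:~R * x) = e2pi x ^ z.
Proof.
have nat_case n : e2pi (n%:R * x) = e2pi x ^+ n.
  elim: n => [|n IHn]; first by rewrite mul0r e2pi0.
  by rewrite -natr1 mulrDl mul1r e2piD IHn exprSr.
case: z => n; first by rewrite -pmulrn nat_case.
by rewrite NegzE mulrNz mulNr e2piN -pmulrn nat_case.
Qed.

Lemma e2pi_int (z : int) : e2pi (z%:~R : R) = 1.
Proof.
rewrite -[_%:~R]mulr1 e2pi_mulz.
suff -> : e2pi (1 : R) = 1 by rewrite exp1rz.
by rewrite /e2pi mulr1 mulr_natl cos2pi sin2pi.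
Qed.

Variable phi : R.

Lemma mtg_eq (g h : mtg phi) :
  (val g).1 = (val h).1 -> (val g).2 = (val h).2 -> g = h.
Proof.
by move=> h1 h2; apply/val_inj/eqP; rewrite -pair_eqE /pair_eq h1 h2 !eqxx.
Qed.

Lemma mtrC (z1 z2 : R) (r1 r2 : int * int) :
  phi * (landau r1 r2)%:~R - phi * (landau r2 r1)%:~R \is a Num.int ->
  (mtr phi z1 r1 * mtr phi z2 r2 = mtr phi z2 r2 * mtr phi z1 r1)%g.
Proof.
move=> /intrP[p /eqP]; rewrite subr_eq => /eqP e.
apply: mtg_eq => /=; last by rewrite addrC.
by rewrite e e2piD e2pi_int mul1r [X in X * _]mulrC.
Qed.

(** For commuting elements the coboundary of [ep] is symmetric and cancels; the differences of
    floors and of Landau forms remain. *)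
Lemma fractionalization_commutator (C : crossed_BTC R (mtg phi))
    (w : mtg phi -> mtg phi -> C) (v m : C) (z1 z2 : R) (r1 r2 : int * int) :
  fractionalization_class w v m -> abelian_anyon v -> abelian_anyon m ->
  0 <= z1 < 1 -> 0 <= z2 < 1 ->
  (mtr phi z1 r1 * mtr phi z2 r2 = mtr phi z2 r2 * mtr phi z1 r1)%g ->
  fuse (w (mtr phi z1 r1) (mtr phi z2 r2)) (dual (w (mtr phi z2 r2) (mtr phi z1 r1)))
  = fuse (fexpz v (Num.floor (z1 + z2 + phi * (landau r1 r2)%:~R)
                   - Num.floor (z1 + z2 + phi * (landau r2 r1)%:~R)))
         (fexpz m (cross r1 r2)).
Proof.
move=> [ep ep_anyon wE] hv hm z1P z2P g12; rewrite (wE z1 z2) // (wE z2 z1) //.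
rewrite [z2 + z1]addrC -g12.
set g1 := mtr phi z1 r1 in g12 *; set g2 := mtr phi z2 r2 in g12 *.
set c := Num.floor _; set d := Num.floor _.
pose E g : abelian_anyons C := Sub (ep g) (ep_anyon g).
pose V : abelian_anyons C := Sub v hv; pose M : abelian_anyons C := Sub m hm.
rewrite -[v]/(val V) -[m]/(val M) -!val_anyon_mulz.
transitivity (val ((E g1 + E g2 - E (g1 * g2)%g + (V *~ c + M *~ landau r1 r2))
  - (E g2 + E g1 - E (g1 * g2)%g + (V *~ d + M *~ landau r2 r1)))) => //.
transitivity (val (V *~ (c - d) + M *~ cross r1 r2)) => //; congr val.
have -> : cross r1 r2 = landau r1 r2 - landau r2 r1.
  by rewrite /cross /landau [r2.1 * _]mulrC.
rewrite [E g2 + _]addrC opprD addrACA subrr add0r !mulrzBr.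
by rewrite opprD addrACA.
Qed.

End MagneticTranslationGroup.

(** * Filling per magnetic unit cell and Hall conductivity *)

Theorem mainTheorem11 (R : realType) (p q : int) (phi : R)
    (q_ge1 : 1 <= q) (coprime_pq : coprimez p q)
    (phiE : phi = p%:~R / q%:~R)
    (C : crossed_BTC R (mtg phi))
    (C0_modular : extends_UMTC C)
    (no_permutation : anyons_not_permuted C)
    (zero : mtg phi -> C) (zeroP : abelian_defect_choice zero)
    (w : mtg phi -> mtg phi -> C) (wP : defect_cocycle zero w)
    (v m : C) (v_anyon : abelian_anyon v) (m_anyon : abelian_anyon m)
    (class_vm : fractionalization_class w v m)
    (n : nat) (n_ge1 : (1 <= n)%N)
    (x : C) (grade_x : grade x = mtr phi n%:R^-1 (0, 0))
    (x_abelian : abelian x) (x_expn : fexpn x n = v)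
    (r1 r2 : int * int) (unit_cell : cross r1 r2 = q) :
  let t1 := mtr phi 0 r1 in
  let t2 := mtr phi 0 r2 in
  fuse (w t1 t2) (dual (w t2 t1)) = fuse (fexpz v p) (fexpz m q) /\
  forall sigma nu : R,
    e2pi sigma = Iinv n x ^+ (2 * n) ->
    e2pi nu = (etasym x t1 t2 / etasym x t2 t1) ^+ n ->
    e2pi nu = mutual_stat v (fexpz m q) * e2pi (p%:~R * sigma) /\
    e2pi nu = mutual_stat v (fexpz m q) * e2pi (q%:~R * phi * sigma).
Proof.
have comm r : (mtr phi n%:R^-1 (0, 0) * mtr phi 0 r
               = mtr phi 0 r * mtr phi n%:R^-1 (0, 0))%g.
  by apply: mtrC; rewrite /landau /= mul0r !mulr0 subrr rpred0.
have q0 : q%:~R != 0 :> R.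
  by rewrite intr_eq0; apply: lt0r_neq0; apply: lt_le_trans q_ge1.
have phiq : phi * q%:~R = p%:~R by rewrite phiE divfK.
(* The Landau forms differ by the cross product q, and phi q = p. This integer makes the
   translations commute and is the exponent of [v]. *)
have flux : phi * (landau r1 r2)%:~R = phi * (landau r2 r1)%:~R + p%:~R.
  rewrite -phiq -mulrDr -intrD -unit_cell; congr (_ * _%:~R).
  by rewrite /cross /landau [r2.1 * _]mulrC addrC subrK.
move=> t1 t2.
have t12 : (t1 * t2 = t2 * t1)%g.
  by apply: mtrC; rewrite flux addrC addKr intr_int.
have z0 : 0 <= (0 : R) < 1 by rewrite lexx ltr01.
have wE : fuse (w t1 t2) (dual (w t2 t1)) = fuse (fexpz v p) (fexpz m q).
  rewrite (fractionalization_commutator class_vm) // flux !add0r unit_cell.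
  by rewrite floorDrz ?intr_int // intrKfloor [X in X - _]addrC addrK.
split=> // sigma nu sigmaE nuE.
have xt r : act (mtr phi 0 r) x = x.
  (* For n = 1 the angle 1/n lies outside [0,1), where the class is described; but then x = v is an
     anyon and is not permuted. *)
  have [n1|n_neq1] := eqVneq n 1%N.
    apply: no_permutation; have /andP[+ _] := v_anyon.
    by rewrite -x_expn n1 /fexpn /= fuse_vacr.
  apply: (act_defect zeroP wP) => //; rewrite grade_x // .
  have wab g h : abelian (w g h) by have [/andP[]] := wP g h.
  apply: fuse_dual_eq_vac => //.
  (* The grade of x has no lattice part, so the Landau forms vanish, the floors agree and the
     commutator is the vacuum. *)
  rewrite (fractionalization_commutator class_vm) //; last first.
    rewrite invr_ge0 ler0n invf_lt1 ?ltr1n ?ltr0n //.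
    by rewrite ltn_neqAle eq_sym n_neq1.
  by rewrite /landau /cross /= !mul0r !mulr0 !subrr fuse_vacl ?abelian_vac.
have gxn : (grade x ^+ n)%g = 1%g.
  by rewrite -grade_fexpn // x_expn; have /andP[/eqP] := v_anyon.
have nuM : e2pi nu = mutual_stat v (fexpz m q) * e2pi sigma ^ p.
  rewrite nuE -(eta_commutator_fexpn n x_abelian (xt r1) (xt r2) t12) x_expn.
  rewrite (eta_commutator_anyon zeroP wP v_anyon t12) wE.
  have /andP[_ v_ab] := v_anyon.
  pose V : abelian_anyons C := Sub v v_anyon.
  pose M : abelian_anyons C := Sub m m_anyon.
  rewrite -[v in fexpz v p]/(val V) -[m]/(val M) -!val_anyon_mulz.
  rewrite -[fuse _ _]/(val (V *~ p + M *~ q)) (mutual_stat_anyonDl _ _ v_anyon).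
  (* Braiding v^p m^q with v splits into M(v,v)^p and M(v,m^q); the former becomes the Hall phase
     through the twist of v = x^n. *)
  rewrite mulrC mutual_statC !val_anyon_mulz -[\val V]/v
    (mutual_stat_fexpz p v_anyon v_anyon).
  rewrite (mutual_stat_diag v_ab) -[v in twist v]x_expn (twist_fexpn x_abelian gxn).
  by rewrite -exprM [(n * 2)%N]mulnC -sigmaE.
by rewrite [q%:~R * phi]mulrC phiq e2pi_mulz.
Qed.
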